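(* Let $\mathcal X$ and $\mathcal Y$ be separable Hilbert spaces, and let $\rho$ be a Borel probability measure on $\mathcal X$ satisfying $$\int_{\mathcal X}\|f\|_{\mathcal X}^2\,d\rho(f)<\infty .$$ Let $\{\xi_j\}_{j=1}^\infty\subset\mathcal X$ be a complete orthonormal system, and let $\Pi_n:\mathcal X\to\mathcal X$ denote the orthogonal projection onto $\mathrm{span}\{\xi_1,\dots,\xi_n\}$. Then for any bounded linear operator $K:\mathcal X\to\mathcal Y$, $$\lim_{n\to\infty}\|K-K\Pi_n\|_{L^2_\rho(\mathcal X;\mathcal Y)}=0 .$$
   Context: $L^2_\rho(\mathcal X;\mathcal Y)$ is the Bochner space of measurable maps $A:\mathcal X\to\mathcal Y$ with $\|A\|_{L^2_\rho(\mathcal X;\mathcal Y)}^2=\int_{\mathcal X}\|A(f)\|_{\mathcal Y}^2\,d\rho(f)<\infty$. *)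

(* Defs.v *)
From HB Require Import structures.
From mathcomp Require Import all_boot all_order all_algebra.
From mathcomp Require Import all_classical all_reals all_analysis.
From mathcomp Require Import complex.
Set Implicit Arguments.
Unset Strict Implicit.
Unset Printing Implicit Defensive.
Import Order.TTheory GRing.Theory Num.Theory.
Import numFieldNormedType.Exports.
Local Open Scope classical_set_scope.
Local Open Scope ring_scope.

(* The scalar field of a Hilbert space is either R or C = R[i]. *)
Variant RorC := RealScalars | ComplexScalars.

Definition scalars (R : realType) (k : RorC) : numFieldType :=
  match k with RealScalars => R | ComplexScalars => complex R end.

Definition conj_scalar (R : realType) (k : RorC) :
    scalars R k -> scalars R k :=
  match k with RealScalars => idfun | ComplexScalars => @conjc R end.

Definition re_scalar (R : realType) (k : RorC) : scalars R k -> R :=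
  match k with RealScalars => idfun | ComplexScalars => @complex.Re R end.

Arguments conj_scalar {R k}.
Arguments re_scalar {R k}.

(* The inner product is linear in its first argument and conjugate-linear in
   the second one. *)
HB.mixin Record CompleteNormedModule_isHilbert (R : realType) (k : RorC) X
    & CompleteNormedModule (scalars R k) X := {
  inner : {dot X for @conj_scalar R k};
  inner_norm : forall x : X, inner x x = `|x| ^+ 2
}.

#[short(type="hilbertType")]
HB.structure Definition Hilbert (R : realType) (k : RorC) :=
  {X of CompleteNormedModule (scalars R k) X
      & CompleteNormedModule_isHilbert R k X}.

Definition separable_space (T : topologicalType) :=
  exists2 D : set T, countable D & dense D.

Definition borel (T : ptopologicalType) := g_sigma_algebraType (@open T).

Section hilbert.
Context {R : realType} {k : RorC}.
Local Notation K := (scalars R k).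

(* `|x| takes values in the scalar field; this is the same number in R. *)
Definition rnorm (X : normedModType K) (x : X) : R := re_scalar `|x|.

Definition bounded_operator (X Y : normedModType K) (A : {linear X -> Y}) :=
  exists M : K, forall x, `|A x| <= M * `|x|.

Section basis.
Variable X : hilbertType R k.
Implicit Type xi : nat -> X.

Definition orthonormal_system xi :=
  forall i j, inner (xi i) (xi j) = (i == j)%:R.

Definition complete_orthonormal_system xi :=
  orthonormal_system xi /\
  forall x, (forall j, inner x (xi j) = 0) -> x = 0.

(* Systems are indexed from 0, so this is the span of the first n vectors. *)
Definition span_first xi (n : nat) : set X :=
  [set x | exists c : 'I_n -> K, x = \sum_(j < n) c j *: xi j].

Definition is_orthogonal_projection (V : set X) (P : X -> X) :=
  forall x, V (P x) /\ forall v, V v -> inner (x - P x) v = 0.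
End basis.

Section bochner.
Variables (X Y : normedModType K) (rho : probability (borel X) R).
Implicit Type A : X -> Y.

Definition L2norm A : \bar R :=
  Lnorm rho 2%:E (fun x => (rnorm (A x))%:E).

(* Borel measurability is the right notion when Y is separable. *)
Definition in_L2 A :=
  measurable_fun setT (A : borel X -> borel Y) /\ (L2norm A < +oo)%E.
End bochner.
End hilbert.

(* Main.v *)
Require Import Defs.
From mathcomp Require Import all_boot all_order all_algebra.
From mathcomp Require Import all_classical all_reals all_analysis.
From mathcomp Require Import measurable_realfun complex.
Set Implicit Arguments.
Unset Strict Implicit.
Unset Printing Implicit Defensive.
Import Order.TTheory GRing.Theory Num.Theory.
Import numFieldNormedType.Exports.
Local Open Scope classical_set_scope.
Local Open Scope ring_scope.

(**
Write [r_n(x) = x - Pi_n x] for the residual of the [n]-th projection.  The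
integrand [|K (r_n(x))|^2] tends to [0] for every [x] and is dominated by the
integrable function [m^2 |x|^2], where [m] bounds [K], so its integral tends to [0] by dominated
convergence; this last part is [L2norm_dominated_cvg].  It rests on three facts
about orthogonal projections, all consequences of Pythagoras' theorem.

- [projection_residual_le]: [|x - P x| <= |x|], which gives the domination.

- [projection_residual_lipschitz]: [x |-> x - P x] is 1-Lipschitz, so that
  [K - K Pi_n] is continuous, hence Borel measurable.

- [complete_projection_cvg]: [Pi_n x] converges to [x].  For [n <= m] Pythagoras
  gives [|Pi_m x - Pi_n x|^2 = |r_n(x)|^2 - |r_m(x)|^2].  The sequence
  [|r_n(x)|^2] is nonincreasing and bounded below, so [Pi_n x] is a Cauchy
  sequence in a complete space; the difference between [x] and its limit is orthogonal to every
  [xi_j], hence zero by completeness of the system.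

Real and complex scalars are treated at once.  Norms take values in the scalar
field, whose order is only partial in the complex case; estimates are made in
[R] through [rnorm], and the embedding [of_real] of [R] in the scalars carries
them back.
*)

(** * Real numbers inside the scalar field *)

Section scalars.
Context {R : realType} {k : RorC}.
Local Notation K := (scalars R k).

Definition of_real : R -> K :=
  match k with RealScalars => idfun | ComplexScalars => @real_complex R end.

Lemma of_realK : cancel of_real re_scalar.
Proof. by rewrite /of_real /re_scalar; case: k. Qed.

Lemma re_scalarK (z : K) : 0 <= z -> of_real (re_scalar z) = z.
Proof.
rewrite /of_real /re_scalar; case: k z => //= -[a b] /=.
by rewrite lecE /= => /andP[/eqP -> _].
Qed.

Lemma of_real0 : of_real 0 = 0.
Proof. by rewrite /of_real; case: k. Qed.

Lemma of_realD r s : of_real (r + s) = of_real r + of_real s.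
Proof. by rewrite /of_real; case: k => //=; rewrite rmorphD. Qed.

Lemma of_realM r s : of_real (r * s) = of_real r * of_real s.
Proof. by rewrite /of_real; case: k => //=; rewrite rmorphM. Qed.

Lemma ler_of_real r s : (of_real r <= of_real s) = (r <= s).
Proof. by rewrite /of_real; case: k => //=; rewrite lecR. Qed.

Lemma conj_scalar0 : conj_scalar (0 : K) = 0.
Proof. by rewrite /conj_scalar; case: k => //=; exact: conjc0. Qed.

Lemma of_real_inj : injective of_real.
Proof. exact: can_inj of_realK. Qed.

Lemma ltr_of_real r s : (of_real r < of_real s) = (r < s).
Proof. by rewrite !lt_neqAle ler_of_real (inj_eq of_real_inj). Qed.

Section rnorm.
Variable X : normedModType K.
Implicit Types x y : X.

Lemma of_rnorm x : of_real (rnorm x) = `|x|.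
Proof. exact: re_scalarK. Qed.

Lemma rnorm_ge0 x : 0 <= rnorm x.
Proof. by rewrite -ler_of_real of_rnorm of_real0. Qed.

Lemma rnorm0 : rnorm (0 : X) = 0.
Proof. by rewrite /rnorm normr0 -of_real0 of_realK. Qed.

Lemma rnormN x : rnorm (- x) = rnorm x.
Proof. by rewrite /rnorm normrN. Qed.

Lemma rnorm_triangle x y : rnorm (x + y) <= rnorm x + rnorm y.
Proof. by rewrite -ler_of_real of_realD !of_rnorm ler_normD. Qed.

Lemma lerB_rnorm x y : rnorm x - rnorm y <= rnorm (x - y).
Proof. by rewrite lerBlDr -{1}(subrK y x) rnorm_triangle. Qed.

Lemma rnorm_continuous : continuous (@rnorm R k X).
Proof.
move=> x; apply/cvgrPdist_lt => e e0.
have e0' : 0 < of_real e by rewrite -of_real0 ltr_of_real.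
near=> y.
have xy : rnorm (x - y) < e.
  rewrite -ltr_of_real of_rnorm; near: y.
  have : y @[y --> x] --> x by exact: cvg_id.
  by move=> /cvgrPdist_lt; exact.
apply: le_lt_trans xy; rewrite ler_distlC; apply/andP; split.
  by rewrite lerBlDr -lerBlDl lerB_rnorm.
by rewrite -lerBlDl -(rnormN (x - y)) opprB lerB_rnorm.
Unshelve. all: by end_near. Qed.
End rnorm.
End scalars.
Arguments of_real {R k}.

(** * Pythagoras' theorem and orthogonal projections *)

Section hilbert.
Context {R : realType} {k : RorC}.
Local Notation K := (scalars R k).
Variable X : hilbertType R k.
Implicit Types x y e : X.

Lemma innerDl x y z : inner (x + y) z = inner x z + inner y z.
Proof. exact: linearDl. Qed.

Lemma innerDr x y z : inner x (y + z) = inner x y + inner x z.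
Proof. exact: linearDr. Qed.

Lemma innerBl x y z : inner (x - y) z = inner x z - inner y z.
Proof. exact: linearBl. Qed.

Lemma innerZl (a : K) x y : inner (a *: x) y = a * inner x y.
Proof. exact: linearZl_LR. Qed.

Lemma inner_conj x y : inner x y = conj_scalar (inner y x).
Proof. by rewrite (@hermitian_subproof _ _ _ _ inner x y) expr0 mul1r. Qed.

Lemma inner_sym0 x y : inner x y = 0 -> inner y x = 0.
Proof. by move=> xy0; rewrite inner_conj xy0 conj_scalar0. Qed.

Lemma pythagoras x y : inner x y = 0 ->
  rnorm (x + y) ^+ 2 = rnorm x ^+ 2 + rnorm y ^+ 2.
Proof.
move=> xy0; apply: (@of_real_inj R k).
rewrite of_realD !expr2 !of_realM !of_rnorm -!expr2 -!inner_norm.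
rewrite innerDl !innerDr xy0 (inner_sym0 xy0).
by rewrite addr0 add0r.
Qed.

Lemma rnorm_le_orth x y : inner x y = 0 -> rnorm x <= rnorm (x + y).
Proof.
move=> xy0; rewrite -(@ler_pXn2r _ 2) ?nnegrE ?rnorm_ge0//.
by rewrite (pythagoras xy0) lerDl exprn_ge0 ?rnorm_ge0.
Qed.

(** The Cauchy-Schwarz inequality against a unit vector: [inner x e *: e] is the
    projection of [x] on the line spanned by [e], so Pythagoras bounds its norm,
    which is [`|inner x e|]. *)
Lemma inner_unit_le x e : inner e e = 1 -> `|inner x e| <= `|x|.
Proof.
move=> ee1; have e1 : `|e| = 1.
  by apply/eqP; rewrite -(@eqrXn2 _ 2)// ?expr1n -?inner_norm ?ee1.
have ex : inner (inner x e *: e) (x - inner x e *: e) = 0.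
  rewrite innerZl (@inner_sym0 (x - inner x e *: e) e) ?mulr0//.
  by rewrite innerBl innerZl ee1 mulr1 subrr.
have := rnorm_le_orth ex.
by rewrite addrC subrK -(@ler_of_real R k) !of_rnorm normrZ e1 mulr1.
Qed.

Section projection.
Variables (V : set X) (P : X -> X).
Hypothesis VB : forall x y, V x -> V y -> V (x - y).
Hypothesis PP : is_orthogonal_projection V P.

(** The increment [x - y] is the sum of the increment of the residuals, which is
    orthogonal to [V], and of the increment of the projections, which lies in
    [V]; the first summand of an orthogonal sum is the shorter one. *)
Lemma projection_residual_lipschitz x y :
  rnorm ((x - P x) - (y - P y)) <= rnorm (x - y).
Proof.
have := @rnorm_le_orth ((x - P x) - (y - P y)) (P x - P y).
have -> : (x - P x) - (y - P y) + (P x - P y) = x - y.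
  by rewrite opprD [X in X + _]addrACA -opprD subrK.
apply; have Pxy : V (P x - P y) by apply: VB; exact: (PP _).1.
by rewrite innerBl ((PP x).2 _ Pxy) ((PP y).2 _ Pxy) subrr.
Qed.

(** Taking for [v] the projection of [x] on a smaller subspace, this measures the
    distance between two nested projections by the decrease of the residual. *)
Lemma projection_residual_split x v : V v ->
  rnorm (x - v) ^+ 2 = rnorm (x - P x) ^+ 2 + rnorm (P x - v) ^+ 2.
Proof.
move=> Vv; rewrite -pythagoras ?subrKA//.
by apply: (PP x).2; apply: VB => //; exact: (PP x).1.
Qed.

Lemma projection_residual_le x : rnorm (x - P x) <= rnorm x.
Proof.
rewrite -[leRHS](congr1 _ (subrK (P x) x)); apply: rnorm_le_orth.
exact/(PP x).2/(PP x).1.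
Qed.
End projection.

Lemma span_first_sub (xi : nat -> X) n x y :
  span_first xi n x -> span_first xi n y -> span_first xi n (x - y).
Proof.
move=> [c ->] [d ->]; exists (fun j => c j - d j).
by rewrite -sumrB; apply: eq_bigr => j _; rewrite scalerBl.
Qed.

Lemma span_first_mono (xi : nat -> X) m n : (m <= n)%N ->
  span_first xi m `<=` span_first xi n.
Proof.
move=> mn x [c ->].
(* The coefficients are extended by zero to all indices. *)
pose g j := if insub j is Some i then c i else 0.
exists (fun j : 'I_n => g j).
have cg j : c j = g j by rewrite /g valK.
under eq_bigr do rewrite cg.
rewrite (big_ord_widen n (fun j => g j *: xi j) mn) big_mkcond /=.
apply: eq_bigr => j _; rewrite /g.
by case: insubP => [i ->|/negbTE ->]; rewrite ?scale0r.
Qed.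

Lemma span_first_mem (xi : nat -> X) n j : (j < n)%N ->
  span_first xi n (xi j).
Proof.
move=> jn; exists (fun i : 'I_n => (val i == j)%:R).
rewrite (bigD1 (Ordinal jn))//= eqxx scale1r big1 ?addr0// => i ij.
by rewrite -val_eqE /= in ij; rewrite (negbTE ij) scale0r.
Qed.

(** * Convergence of the projections along a complete system *)

(** Pythagoras makes the projections a Cauchy sequence, without recourse to the
    Fourier coefficients of [x]; completeness of the system identifies the
    limit as [x]. *)
Lemma complete_projection_cvg (xi : nat -> X) (Pi : nat -> X -> X) x :
  complete_orthonormal_system xi ->
  (forall n, is_orthogonal_projection (span_first xi n) (Pi n)) ->
  Pi n x @[n --> \oo] --> x.
Proof.
move=> [xi1 xi_tot] PiP.
pose r n := rnorm (x - Pi n x) ^+ 2.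
have r_split n m : (n <= m)%N -> r n = r m + rnorm (Pi m x - Pi n x) ^+ 2.
  move=> nm; apply: (projection_residual_split (@span_first_sub xi m) (PiP m)).
  exact/(span_first_mono nm)/(PiP n x).1.
have r_noninc : nonincreasing_seq r.
  by move=> n m nm; rewrite (r_split _ _ nm) lerDl exprn_ge0 ?rnorm_ge0.
have r_cvg : cvgn r.
  apply: nonincreasing_is_cvgn => //; exists 0 => _ [n _ <-].
  by rewrite exprn_ge0 ?rnorm_ge0.
have /cvg_ex[y Pi_y] : cvg (Pi n x @[n --> \oo]).
  apply/cauchy_cvgP/cauchy_exP => eps eps0.
  have epsE := re_scalarK (ltW eps0).
  set e := re_scalar eps in epsE.
  have e0 : 0 < e by rewrite -(@ltr_of_real R k) of_real0 epsE.
  have /cvgrPdist_lt/(_ (e ^+ 2)) := r_cvg.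
  rewrite exprn_gt0// => /(_ isT)[N _ rN].
  exists (Pi N x); exists N => // n /= Nn.
  rewrite -ball_normE /ball_ /= -epsE -of_rnorm ltr_of_real.
  rewrite -(@ltr_pXn2r _ 2) ?nnegrE ?rnorm_ge0 ?ltW//.
  rewrite -rnormN opprB.
  have -> : rnorm (Pi n x - Pi N x) ^+ 2 = r N - r n.
    by rewrite (r_split _ _ Nn) addrAC subrr add0r.
  apply: le_lt_trans (rN N (leqnn N)).
  rewrite distrC ger0_norm ?subr_ge0 ?lerB ?nonincreasing_cvgn_ge//.
suff xy : x - y = 0 by move: Pi_y; rewrite -(subr0_eq xy).
(* The residual of [Pi n x] is orthogonal to [xi j] as soon as [j < n], so
   [inner (x - y) (xi j)] is at most [`|Pi n x - y|], which is small. *)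
apply: xi_tot => j; apply/eqP; rewrite -normr_le0.
apply/ler_addgt0Pl => eps eps0; rewrite addr0.
have [N _ yN] := (cvgrPdist_lt _ _).1 Pi_y eps eps0.
pose n := maxn N j.+1.
have -> : inner (x - y) (xi j) = inner (Pi n x - y) (xi j).
  apply/subr0_eq; rewrite -innerBl opprB subrKA.
  by apply: (PiP n x).2; apply: span_first_mem; rewrite leq_maxr.
apply: le_trans (inner_unit_le _ _) _; first by rewrite xi1 eqxx.
by rewrite distrC ltW//; apply: yN; exact: leq_maxl.
Qed.
End hilbert.

(** * Measurability and dominated convergence in L2 *)

Lemma continuous_borel_measurable (S T : ptopologicalType) (f : S -> T) :
  continuous f -> measurable_fun setT (f : borel S -> borel T).
Proof.
move=> /continuousP cf.
apply: (@measurability _ _ (borel S) (borel T) setT f (@open T)) => //.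
by move=> _ [B oB <-]; rewrite setTI; apply: sub_sigma_algebra; exact: cf.
Qed.

Lemma continuous_real_measurable (R : realType) (S : ptopologicalType)
  (f : S -> R) : continuous f -> measurable_fun setT (f : borel S -> R).
Proof.
move=> /continuousP cf; apply: (measurability _ (RGenOpens.measurableE R)).
move=> _ [_ [a [b ->] <-]]; rewrite setTI; apply: sub_sigma_algebra.
exact/cf/interval_open.
Qed.

Section L2.
Context {R : realType} {k : RorC}.
Local Notation K := (scalars R k).
Variables (X Y : normedModType K) (rho : probability (borel X) R).

Lemma L2normE (A : X -> Y) :
  L2norm rho A = sqrte (\int[rho]_x ((rnorm (A x)) ^+ 2)%:E).
Proof.
rewrite /L2norm Lnorm.unlock /= -poweR12_sqrt; last first.
  by apply: integral_ge0 => x _; rewrite lee_fin exprn_ge0 ?rnorm_ge0.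
congr (_ `^ _)%E; apply: eq_integral => x _.
by rewrite ger0_norm ?rnorm_ge0// powR_mulrn ?rnorm_ge0.
Qed.

(** Dominated convergence applied to the squared norms; the square root, which is
    continuous at [0], then passes from the integrals to the [L2] norms. *)
Lemma L2norm_dominated_cvg (A : nat -> X -> Y) (g : X -> R) :
  (forall n, continuous (A n)) ->
  measurable_fun setT (g : borel X -> R) ->
  (\int[rho]_x ((g x) ^+ 2)%:E < +oo)%E ->
  (forall n x, rnorm (A n x) <= g x) ->
  (forall x, A n x @[n --> \oo] --> 0) ->
  (forall n, in_L2 rho (A n)) /\ L2norm rho (A n) @[n --> \oo] --> 0%E.
Proof.
move=> cA mg g2 Ag A0.
pose F n x := ((rnorm (A n x)) ^+ 2)%:E.
have mF n : measurable_fun setT (F n : borel X -> \bar R).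
  apply/measurable_EFinP; apply: measurable_funX.
  apply: continuous_real_measurable => x.
  by apply: continuous_comp; [exact: cA|exact: rnorm_continuous].
have Fg n x : (`|F n x| <= ((g x) ^+ 2)%:E)%E.
  rewrite gee0_abs ?lee_fin ?exprn_ge0 ?rnorm_ge0//.
  by rewrite lerXn2r ?nnegrE ?rnorm_ge0// (le_trans _ (Ag n x)) ?rnorm_ge0.
have ig : rho.-integrable setT (fun x => ((g x) ^+ 2)%:E).
  apply/integrableP; split.
    by apply/measurable_EFinP; apply: measurable_funX.
  by under eq_integral do rewrite gee0_abs ?lee_fin ?exprn_even_ge0//.
have F0 x : F n x @[n --> \oo] --> 0%E.
  apply: cvg_EFin; first exact: nearW.
  rewrite -[0](expr0n R 2) -(rnorm0 Y) /comp /=.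
  rewrite expr2; under eq_fun do rewrite expr2; apply: cvgM;
    by apply: cvg_comp (A0 x) _; exact: rnorm_continuous.
have F0ae : {ae rho, forall x, setT x -> F n x @[n --> \oo] --> cst 0%E x}.
  by apply: aeW => x _; exact: F0.
have Fgae : {ae rho, forall x n, setT x -> (`|F n x| <= ((g x) ^+ 2)%:E)%E}.
  by apply: aeW => x n _; exact: Fg.
have [_ _] := dominated_convergence measurableT mF
  (measurable_cst _) F0ae ig Fgae.
rewrite integral0 => IF0.
have Ifin n : (\int[rho]_x F n x)%E \is a fin_num.
  apply: integrable_fin_num => //.
  apply: le_integrable ig => // x _.
  by rewrite (le_trans (Fg n x))// lee_abs.
split=> [n|].
  split; first exact: continuous_borel_measurable.
  by rewrite L2normE -(fineK (Ifin n)) ltry.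
under eq_fun do rewrite L2normE -(fineK (Ifin _)) /=.
apply: cvg_EFin; first exact: nearW.
have := cvg_comp _ _ (fine_cvg IF0) (@sqrt_continuous R 0).
by rewrite sqrtr0; apply.
Qed.
End L2.

Lemma rnorm_lipschitz_continuous (R : realType) (k : RorC)
    (X Y : normedModType (scalars R k)) (f : X -> Y) (c : R) :
  (forall x y, rnorm (f x - f y) <= c * rnorm (x - y)) -> continuous f.
Proof.
(* [c] may vanish or be negative; [`|c| + 1] is a positive constant above it. *)
move=> fc; have c10 : 0 < `|c| + 1 by rewrite ltr_wpDl.
move=> x; apply/cvgrPdist_lt => e e0; have eE := re_scalarK (ltW e0).
have re0 : 0 < re_scalar e by rewrite -(@ltr_of_real R k) of_real0 eE.
near=> y; rewrite -of_rnorm -eE ltr_of_real.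
apply: (@le_lt_trans _ _ ((`|c| + 1) * rnorm (x - y))).
  apply: le_trans (fc x y) _; rewrite ler_wpM2r ?rnorm_ge0//.
  by rewrite (le_trans (ler_norm c))// lerDl.
rewrite -ltr_pdivlMl// mulrC -(@ltr_of_real R k) of_rnorm.
near: y; have : y @[y --> x] --> x by exact: cvg_id.
by move=> /cvgrPdist_lt; apply; rewrite -of_real0 ltr_of_real divr_gt0.
Unshelve. all: by end_near. Qed.

Theorem theorem4p1 (R : realType) (k : RorC) (X Y : hilbertType R k)
    (sepX : separable_space X) (sepY : separable_space Y)
    (rho : probability (borel X) R)
    (rho2 : (\int[rho]_(f in setT) ((rnorm f) ^+ 2)%:E < +oo)%E)
    (xi : nat -> X) (xi_cons : complete_orthonormal_system xi)
    (Pi : nat -> X -> X)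
    (PiP : forall n, is_orthogonal_projection (span_first xi n) (Pi n))
    (K : {linear X -> Y}) (K_bounded : bounded_operator K) :
  (forall n, in_L2 rho (fun f => K f - K (Pi n f))) /\
  L2norm rho (fun f => K f - K (Pi n f)) @[n --> \oo] --> 0%E.
Proof.
have [M KM] := K_bounded.
pose m := re_scalar `|M|.
have m0 : 0 <= m by exact: rnorm_ge0.
(* The bound [M] lies in [K] and need not be real, for instance if [X] is
   trivial; since [M * `|x|] is nonnegative, it equals [`|M| * `|x|]. *)
have Km x : rnorm (K x) <= m * rnorm x.
  rewrite -(@ler_of_real R k) of_realM !of_rnorm.
  apply: le_trans (KM x) _.
  by rewrite -[leLHS]ger0_norm ?normrM ?normr_id// (le_trans _ (KM x)).
have K_cont : continuous K.
  by apply: (rnorm_lipschitz_continuous (c := m)) => x y; rewrite -linearB.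
apply: (@L2norm_dominated_cvg _ _ _ _ _ _ (fun x => m * rnorm x)).
- move=> n; apply: (rnorm_lipschitz_continuous (c := m)) => x y.
  rewrite -!linearB (le_trans (Km _))// ler_wpM2l//.
  exact: projection_residual_lipschitz (@span_first_sub _ _ _ xi n) (PiP n) _ _.
- apply: measurable_funM => //; apply: continuous_real_measurable.
  exact: rnorm_continuous.
- under eq_integral do rewrite exprMn EFinM.
  rewrite ge0_integralZl//.
  + by rewrite lte_mul_pinfty// lee_fin exprn_ge0.
  + apply/measurable_EFinP; apply: measurable_funX.
    by apply: continuous_real_measurable; exact: rnorm_continuous.
  + by move=> x _; rewrite lee_fin exprn_ge0 ?rnorm_ge0.
  + by rewrite lee_fin exprn_ge0.
- move=> n x; rewrite -linearB (le_trans (Km _))// ler_wpM2l//.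
  exact: (projection_residual_le (PiP n)).
- move=> x; rewrite -[0](subrr (K x)); apply: cvgB; first exact: cvg_cst.
  exact: (cvg_comp _ _ (complete_projection_cvg (x := x) xi_cons PiP) (K_cont x)).
Qed.
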